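(* Let $f:\mathbb{R}^n\to\mathbb{R}$ be convex and differentiable with $L$-Lipschitz gradient ($L>0$), let $g:\mathbb{R}^n\to\mathbb{R}\cup\{+\infty\}$ be convex, proper and lower semi-continuous, let $F=f+g$, assume that $X^\star=\operatorname{argmin}F$ is nonempty and closed with $F^\star=\min F>-\infty$, and let $x^\star\in X^\star$. Take $\gamma\in\,]0,1/L]$. Let $(t_j)$ be defined by $t_0=0$ and either $t_{j+1}=\frac{1+\sqrt{1+4t_j^2}}{2}$, or $t_{j+1}=\frac{j+a}{a}$ with $a>2$. Consider the proximal gradient algorithm with alternated extrapolation, with initial point $x_0$, whose iterations read, for $k$ even, $$y_{k+1}=\mathsf{T}_\gamma(x_k),\qquad x_{k+1}=y_{k+1}-\frac{1}{t_{k/2+1}}(y_{k+1}-y_k)+\frac{t_{k/2}-1}{t_{k/2+1}}(y_k-y_{k-1}),$$ $$y_{k+2}=\mathsf{T}_\gamma(x_{k+1}),\qquad x_{k+2}=y_{k+2}.$$ Then this algorithm verifies, for $k$ even, $$F(y_k)-F^\star\le\frac{\|x_0-x^\star\|^2}{2\gamma\,t_{k/2}^2}=\mathcal{O}\left(\frac1{k^2}\right)\qquad\text{and}\qquad\|\mathsf{T}_\gamma(y_k)-y_k\|^2=o\left(\frac1{t_{k/2}^2}\right)=o\left(\frac1{k^2}\right).$$ Moreover, if $F$ verifies the Kurdyka-Łojasiewicz (KL) property with $\theta\in\,]0,1]$ and $C>0$, i.e. $$\operatorname{dist}(0,\partial F(x))\ge\frac1C\,(F(x)-F^\star)^{1-\theta}\qquad\text{for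 all }x\notin\operatorname{argmin}F,$$ then, for $k$ odd, $$F(y_k)-F^\star=o\left(\frac{1}{k^{\frac{1}{1-\theta}}}\right).$$
   Context: $\|\cdot\|$ is the Euclidean norm on $\mathbb{R}^n$. The proximal operator of a function $h$ is $\mathbf{prox}_h(x)=\operatorname{argmin}_{w\in\mathbb{R}^n}\left(h(w)+\frac12\|w-x\|^2\right)$, and the proximal gradient operator is $\mathsf{T}_\gamma(x)=\mathbf{prox}_{\gamma g}(x-\gamma\nabla f(x))$. $\partial F$ is the convex subdifferential of $F$, and $\operatorname{dist}(0,S)=\inf_{s\in S}\|s\|$ (with value $+\infty$ if $S$ is empty). Asymptotic notations are for $k\to\infty$ along the indicated parity. *)

(* Defs.v *)
From HB Require Import structures.
From mathcomp Require Import all_boot all_order all_algebra.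
From mathcomp Require Import all_classical all_reals all_analysis.

Set Implicit Arguments.
Unset Strict Implicit.
Unset Printing Implicit Defensive.

Import Order.TTheory GRing.Theory Num.Theory.
Import numFieldTopology.Exports numFieldNormedType.Exports.

Local Open Scope classical_set_scope.
Local Open Scope ring_scope.

Section Euclidean.
Context {R : realType} {n : nat}.
Implicit Types (u v x : 'rV[R]_n).

Definition dot u v : R := \sum_(i < n) u 0 i * v 0 i.

(* The library norm `|u| on 'rV[R]_n is the sup norm; it induces the same
   topology, so it is only used below through [differentiable],
   [lower_semicontinuous] and [closed]. *)
Definition enorm u : R := Num.sqrt (dot u u).

Definition grad (f : 'rV[R]_n -> R) x : 'rV[R]_n :=
  \row_(i < n) 'D_(delta_mx 0 i) f x.

End Euclidean.

Section ConvexAnalysis.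
Context {R : realType} {n : nat}.
Local Notation E := 'rV[R]_n.
Local Open Scope ereal_scope.
Implicit Types (h F g : E -> \bar R) (f : E -> R).

(* Functions with values in R U {+oo} are functions into \bar R that never
   take the value -oo; this is part of [proper_fun]. *)
Definition proper_fun h : Prop :=
  (forall x, h x != -oo) /\ (exists x, h x != +oo).

(* At the endpoints, 0 * +oo = 0 makes the inequality trivial, so this is the
   usual convexity of a function into R U {+oo}. *)
Definition econvex_fun h : Prop :=
  forall (x y : E) (s : R), (0 <= s <= 1)%R ->
    h (s *: x + (1 - s) *: y)%R <= s%:E * h x + (1 - s)%:E * h y.

Definition argmin h : set E := [set x | forall w, h x <= h w].

Definition infval h : \bar R := ereal_inf (range h).

(* The argmin is a singleton when h is proper, convex and lower
   semicontinuous; the default value 0 is used only if it is empty. *)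
Definition prox h (x : E) : E :=
  xget 0%R (argmin (fun w => h w + (2^-1 * enorm (w - x) ^+ 2)%:E)).

Definition prox_grad (gamma : R) f g (x : E) : E :=
  prox (fun w => gamma%:E * g w) (x - gamma *: grad f x)%R.

Definition composite f g (x : E) : \bar R := (f x)%:E + g x.

Definition subdiff F (x : E) : set E :=
  [set s | forall w, F x + (dot s (w - x)%R)%:E <= F w].

Definition dist0 (S : set E) : \bar R :=
  ereal_inf [set (enorm s)%:E | s in S].

Definition KL F (theta C : R) : Prop :=
  forall x, ~ argmin F x ->
    (C^-1)%:E * (F x - infval F) `^ (1 - theta) <= dist0 (subdiff F x).

End ConvexAnalysis.

Section Algorithm.
Context {R : realType} {n : nat}.
Local Notation E := 'rV[R]_n.

Definition nesterov_step (t : nat -> R) : Prop :=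
  forall j, t j.+1 = (1 + Num.sqrt (1 + 4 * t j ^+ 2)) / 2.

Definition affine_step (t : nat -> R) : Prop :=
  exists2 a : R, 2 < a & forall j, t j.+1 = (j%:R + a) / a.

(* The first extrapolation (k = 0) involves y_0 and y_{-1}, which the recursion
   does not produce: y_0 = y_{-1} = x_0.  The value y_{-1} is read as
   y 0.-1 = y 0. *)
Definition alternated_extrapolation (T : E -> E) (t : nat -> R) (x0 : E)
    (x y : nat -> E) : Prop :=
  [/\ x 0%N = x0, y 0%N = x0 &
    forall k, ~~ odd k ->
    [/\ y k.+1 = T (x k),
        x k.+1 = y k.+1 - (1 / t k./2.+1) *: (y k.+1 - y k)
                        + ((t k./2 - 1) / t k./2.+1) *: (y k - y k.-1),
        y k.+2 = T (x k.+1) &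
        x k.+2 = y k.+2]].

End Algorithm.

Section Asymptotics.
Context {R : realType}.

Definition even_infty : set_system nat := within [set k | ~~ odd k] \oo.
Definition odd_infty : set_system nat := within [set k | odd k] \oo.

(* Finiteness is required because [fine] sends infinite values to 0. *)
Definition odd_elittleo (u : nat -> \bar R) (v : nat -> R) : Prop :=
  (\forall k \near odd_infty, u k \is a fin_num) /\
  (fun k => fine (u k) : R^o) =o_odd_infty (fun k => v k : R^o).

(* 1 / k^(1/(1-theta)); for theta = 1 the exponent is +oo and the rate is 0
   (from k = 2 on), so that being little-o of it means vanishing for all large
   k.  The case split is needed because 0^-1 = 0 would give the rate 1. *)
Definition KL_rate (theta : R) (k : nat) : R :=
  if theta == 1 then 0 else 1 / (k%:R `^ (1 / (1 - theta))).

End Asymptotics.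

(* Main.v *)
Require Import Defs.
From HB Require Import structures.
From mathcomp Require Import all_boot all_order all_algebra.
From mathcomp Require Import all_classical all_reals all_analysis.
From mathcomp Require Import ring lra.

Set Implicit Arguments.
Unset Strict Implicit.
Unset Printing Implicit Defensive.

Import Order.TTheory GRing.Theory Num.Theory.
Import numFieldTopology.Exports numFieldNormedType.Exports.

Local Open Scope classical_set_scope.
Local Open Scope ring_scope.

(** The alternated scheme is an accelerated method seen through the right
    variables. Put u_j = y_{2j}, v_j = y_{2j+1} = T u_j and
    z_j = u_j + (t_j - 1)(u_j - v_{j-1}). The extrapolated point is then
    x_{2j+1} = v_j + (z_j - v_j) / t_{j+1}, and u_{j+1} = T x_{2j+1}.

    Everything rests on the inequality ([prox_grad_inequality])
      gamma F(T x) + |T x - w|^2 / 2 <= gamma F(w) + |x - w|^2 / 2,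
    which combines the descent lemma, the gradient inequality of f and the
    variational characterization of the prox. Applied at x_{2j+1} with
    w = v_j + (xs - v_j) / t_{j+1}, it compares the energy
      E_j = 2 gamma t_j^2 (F(u_j) - F(xs)) + |z_j - xs|^2
    with E_{j+1}, because t_{j+1}^2 - t_{j+1} <= t_j^2. Applied at u_j with
    w = u_j, it shows that the plain step from u_j to v_j gains a further
    t_j^2 |T u_j - u_j|^2. Hence ([lyapunov_decrease])
      E_{j+1} + t_j^2 |T u_j - u_j|^2 <= E_j.
    As t_0 = 0, E_0 = |x0 - xs|^2, even if F(x0) is infinite: this is the rate
    on F(u_j). The gains are summable, so t_j^2 |T u_j - u_j|^2 tends to 0, and
    t_j grows at least linearly: these are the little-o rates on the residual.

    At odd indices, optimality of the prox exhibits a subgradient of F at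
    v_j = T u_j of norm at most (1/gamma + L) |T u_j - u_j|. The KL inequality
    turns this o(1/j) bound into the rate on F(v_j) ([KL_residual],
    [gap_powR_le]); for theta = 1 it bounds the subgradients at points
    other than minimizers away from 0, so that v_j is eventually a minimizer.

    The operator T is defined by a choice in an argmin, which must be shown
    nonempty. The first-order optimality of xs provides an affine minorant of g,
    so the objective of the prox has bounded sublevel sets, and a lower
    semicontinuous function attains its infimum on a compact set. All
    first-order conditions are obtained in the same way: along a segment of
    parameter s the relevant inequality reads 0 <= s A + s^2 B, whence 0 <= A
    ([ge0_of_quadratic]). *)

(** * Euclidean inner product and norm *)

Section EuclideanTheory.
Context {R : realType} {n : nat}.
Implicit Types (u v w : 'rV[R]_n) (a c : R).

Lemma dotC u v : dot u v = dot v u.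
Proof. by apply: eq_bigr => i _; rewrite mulrC. Qed.

Lemma dotDl u v w : dot (u + v) w = dot u w + dot v w.
Proof. by rewrite -big_split; apply: eq_bigr => i _; rewrite mxE mulrDl. Qed.

Lemma dotZl a u v : dot (a *: u) v = a * dot u v.
Proof. by rewrite mulr_sumr; apply: eq_bigr => i _; rewrite mxE mulrA. Qed.

Lemma dotNl u v : dot (- u) v = - dot u v.
Proof. by rewrite -scaleN1r dotZl mulN1r. Qed.

Lemma dotDr u v w : dot w (u + v) = dot w u + dot w v.
Proof. by rewrite !(dotC w) dotDl. Qed.

Lemma dotZr a u v : dot v (a *: u) = a * dot v u.
Proof. by rewrite !(dotC v) dotZl. Qed.

Lemma dotNr u v : dot v (- u) = - dot v u.
Proof. by rewrite !(dotC v) dotNl. Qed.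

Definition dotE := (dotDl, dotDr, dotZl, dotZr, dotNl, dotNr).

Lemma dotxx_ge0 u : 0 <= dot u u.
Proof. by apply: sumr_ge0 => i _; rewrite -expr2 sqr_ge0. Qed.

Lemma sqr_enorm u : enorm u ^+ 2 = dot u u.
Proof. by rewrite sqr_sqrtr ?dotxx_ge0. Qed.

Lemma sqr_enormD u v :
  enorm (u + v) ^+ 2 = enorm u ^+ 2 + 2 * dot u v + enorm v ^+ 2.
Proof. by rewrite !sqr_enorm !dotE (dotC v u); ring. Qed.

Lemma enorm_ge0 u : 0 <= enorm u.
Proof. exact: sqrtr_ge0. Qed.

Lemma enormN u : enorm (- u) = enorm u.
Proof. by rewrite /enorm dotNl dotNr opprK. Qed.

Lemma enormZ a u : enorm (a *: u) = `|a| * enorm u.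
Proof. by rewrite /enorm dotZl dotZr mulrA -expr2 sqrtrM ?sqr_ge0// sqrtr_sqr. Qed.

(** Cauchy-Schwarz, from the square norm of (v.v) u - (u.v) v. *)
Lemma dot_le_enorm u v : dot u v <= enorm u * enorm v.
Proof.
have [v0|vn0] := eqVneq (dot v v) 0.
  suff -> : dot u v = 0 by rewrite mulr_ge0 ?enorm_ge0.
  move/eqP: v0; rewrite psumr_eq0 => [/allP v0|i _]; last by rewrite -expr2 sqr_ge0.
  apply: big1 => i _; have := v0 i (mem_index_enum _).
  by rewrite /= mulf_eq0 orbb => /eqP ->; rewrite mulr0.
have vpos : 0 < dot v v by rewrite lt_def vn0 dotxx_ge0.
rewrite /enorm -sqrtrM ?dotxx_ge0//.
apply: (le_trans (ler_norm _)); rewrite -sqrtr_sqr ler_sqrt; last first.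
  by rewrite mulr_ge0 ?dotxx_ge0.
have := dotxx_ge0 (dot v v *: u - dot u v *: v).
rewrite !dotE (dotC v u) => sq_ge0.
rewrite -(ler_pM2l vpos) -subr_ge0; apply: le_trans sq_ge0 _.
by rewrite le_eqVlt; apply/orP; left; apply/eqP; ring.
Qed.

Lemma enormD u v : enorm (u + v) <= enorm u + enorm v.
Proof.
rewrite -(ler_pXn2r (ltn0Sn 1)) ?nnegrE ?addr_ge0 ?enorm_ge0//.
rewrite sqr_enormD.
have := dot_le_enorm u v; nra.
Qed.

(** Links the Euclidean norm with the sup norm that carries the topology, in
    the only direction that compactness requires. *)
Lemma normr_le_enorm u : `|u| <= enorm u.
Proof.
have [M0|] := leP `|u| 0; first exact: le_trans M0 (enorm_ge0 _).
rewrite [in X in X -> _]/Num.norm/= mx_normrE => upos.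
rewrite /Num.norm/= mx_normrE; apply/bigmax_leP; split; first exact: enorm_ge0.
move=> [i j] _ /=; rewrite (ord1 i) -sqrtr_sqr ler_sqrt ?dotxx_ge0//.
by rewrite /dot (bigD1 j)//= expr2 lerDl; apply: sumr_ge0 => k _; rewrite -expr2 sqr_ge0.
Qed.

Lemma coordB_continuous u i : continuous (fun w : 'rV[R]_n => (w - u) 0 i).
Proof.
have -> : (fun w : 'rV[R]_n => (w - u) 0 i) = (fun w => w 0 i + (- u) 0 i).
  by apply/funext => w; rewrite mxE.
move=> w; apply: (@cvgD R R^o 'rV[R]_n (nbhs (w : 'rV[R]_n)) (nbhs_filter _)).
  exact: (@coord_continuous R 1 n 0 i w).
exact: cvg_cst.
Qed.

Lemma sqr_enorm_continuous u : continuous (fun w => enorm (w - u) ^+ 2).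
Proof.
under eq_fun do rewrite sqr_enorm.
apply: (continuous_big (op := +%R)); first exact: add_continuous.
move=> i _ w.
apply: (@cvgM R 'rV[R]_n (nbhs (w : 'rV[R]_n)) (nbhs_filter _)); exact: coordB_continuous.
Qed.

End EuclideanTheory.

(** * Functions with a Lipschitz gradient *)

Section SmoothFunctions.
Context {R : realType} {n : nat}.
Implicit Types (f : 'rV[R]_n -> R) (x d : 'rV[R]_n).

Lemma derive_grad f x d : differentiable f x -> 'D_d f x = dot (grad f x) d.
Proof.
move=> fx; rewrite deriveE// [in LHS](row_sum_delta d) linear_sum.
by apply: eq_bigr => i _; rewrite linearZ mxE deriveE// mulrC.
Qed.

Lemma is_derive_line f x d (s : R) : differentiable f (x + s *: d) ->
  is_derive s 1 (fun r : R => f (x + r *: d)) (dot (grad f (x + s *: d)) d).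
Proof.
move=> fs.
have E : (fun h : R => h^-1 *: (((fun r : R => f (x + r *: d)) \o shift s) (h *: 1)
      - f (x + s *: d)))
    = (fun h => h^-1 *: ((f \o shift (x + s *: d)) (h *: d) - f (x + s *: d))).
  apply/funext => h /=; congr (_ *: (f _ - _)).
  have -> : h *: (1 : R) = h by rewrite -[RHS]mulr1.
  by rewrite scalerDl addrCA.
apply: DeriveDef; first by rewrite /derivable E; exact: diff_derivable.
by rewrite /derive E -derive_grad.
Qed.

(** Mean value theorem for s |-> f (x + s d) minus its quadratic upper model on
    [0, 1]: the derivative of the difference is nonpositive. *)
Lemma descent_lemma f (L : R) x d : (forall z, differentiable f z) -> 0 <= L ->
  (forall a b, enorm (grad f a - grad f b) <= L * enorm (a - b)) ->
  f (x + d) <= f x + dot (grad f x) d + L / 2 * enorm d ^+ 2.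
Proof.
move=> fdiff L0 flip.
pose q (s : R) := - (s * dot (grad f x) d) - L / 2 * enorm d ^+ 2 * s ^+ 2.
pose phi (s : R) := f (x + s *: d) + q s.
pose dphi (s : R) := dot (grad f (x + s *: d)) d
  + (- dot (grad f x) d - L * enorm d ^+ 2 * s).
have dphiP (s : R) : is_derive s 1 phi (dphi s).
  apply: is_deriveD; first exact: is_derive_line.
  apply: is_derive_eq.
  by rewrite /GRing.scale /=; field.
have phi_cont : {within `[0, 1], continuous phi}.
  apply: continuous_subspaceT => s.
  exact/differentiable_continuous/derivable1_diffP/ex_derive.
have [c c01] := MVT_segment ler01 (fun s _ => dphiP s) phi_cont.
rewrite subr0 mulr1 /phi scale1r scale0r addr0 /q mul0r expr0n mulr0 mul1r expr1n mulr1.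
have : dphi c <= 0.
  rewrite /dphi addrA -dotNl -dotDl subr_le0 (le_trans (dot_le_enorm _ _))//.
  rewrite [leRHS](_ : _ = L * (c * enorm d) * enorm d); last by ring.
  rewrite ler_wpM2r ?enorm_ge0// (le_trans (flip _ _))// addrAC subrr add0r enormZ ger0_norm//.
  by move: c01; rewrite in_itv/= => /andP[].
lra.
Qed.

(** Stands for dividing by s and letting s tend to 0; it turns the minimality
    or convexity inequalities along a segment into first-order conditions. *)
Lemma ge0_of_quadratic (A B : R) :
  (forall s, 0 < s -> s <= 1 -> 0 <= s * A + s ^+ 2 * B) -> 0 <= A.
Proof.
move=> H; rewrite leNgt; apply/negP => A0.
have B0 : 0 < B by have := H 1; rewrite mul1r expr1n mul1r; lra.
(* with this s, s * B <= - A / 2, so that A + s * B < 0 *)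
pose s := Num.min 1 (- A / (2 * B)).
have r0 : 0 < - A / (2 * B) by rewrite divr_gt0 ?oppr_gt0 ?mulr_gt0.
have s0 : 0 < s by rewrite lt_min ltr01.
have s1 : s <= 1 by rewrite ge_min lexx.
have := H s s0 s1; rewrite expr2 -mulrA -mulrDr pmulr_rge0//.
have : s * B <= - A / 2.
  have : s <= - A / (2 * B) by rewrite ge_min lexx orbT.
  by rewrite invfM mulrA ler_pdivlMr.
lra.
Qed.

Lemma convex_functionE f : convex_function [set: 'rV[R]_n] f ->
  forall x w s, 0 <= s -> s <= 1 -> f (x + s *: (w - x)) <= f x + s * (f w - f x).
Proof.
move=> cf x w s s0 s1.
have cfs : f (s *: w + (1 - s) *: x) <= s * f w + (1 - s) * f x.
  by apply: (cf (Itv01 s0 s1) w x); rewrite in_setT.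
have -> : x + s *: (w - x) = s *: w + (1 - s) *: x.
  by rewrite scalerBl scale1r scalerBr addrCA.
by apply: le_trans cfs _; rewrite le_eqVlt; apply/orP; left; apply/eqP; ring.
Qed.

(** The descent lemma applied to - f bounds f from below by its quadratic model
    along the segment, while convexity bounds it by its chord from above. *)
Lemma grad_inequality f (L : R) x w : convex_function [set: 'rV[R]_n] f ->
  (forall z, differentiable f z) -> 0 <= L ->
  (forall a b, enorm (grad f a - grad f b) <= L * enorm (a - b)) ->
  f x + dot (grad f x) (w - x) <= f w.
Proof.
move=> fconv fdiff L0 flip; rewrite -subr_ge0 opprD addrA.
apply: (@ge0_of_quadratic _ (L / 2 * enorm (w - x) ^+ 2)) => s s0 s1.
have Ngrad a : grad (- f) a = - grad f a.
  by apply/rowP => i; rewrite !mxE deriveN//; exact: diff_derivable.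
have := @descent_lemma (- f) L x (s *: (w - x)).
rewrite Ngrad dotNl dotZr enormZ exprMn real_normK ?num_real// !opprfctE.
have := convex_functionE fconv x w (ltW s0) s1.
move=> H1 H2; have /H2 : forall z, differentiable (- f) z by move=> z; exact: differentiableN.
move=> /(_ L0) H3; have : - f (x + s *: (w - x)) <=
    - f x - s * dot (grad f x) (w - x) + L / 2 * (s ^+ 2 * enorm (w - x) ^+ 2).
  by apply: H3 => a b; rewrite !Ngrad -opprD enormN.
move: H1; nra.
Qed.

End SmoothFunctions.

(** * Minimizers of lower semicontinuous functions *)

Section LowerSemicontinuity.
Local Open Scope ereal_scope.

(** The sublevel sets B w of the values h w, for w in K, form a filter base on
    K. By lower semicontinuity a cluster point of that filter lies in all of
    them. *)
Lemma lsc_compact_min (X : topologicalType) (R : realType) (h : X -> \bar R)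
    (K : set X) : lower_semicontinuous h -> compact K -> K !=set0 ->
  exists2 x, K x & forall w, K w -> h x <= h w.
Proof.
move=> hlsc Kco [k0 Kk0].
pose B w := K `&` [set v | h v <= h w].
have Bnest v w : K v -> K w -> exists2 u, K u & B u `<=` B v `&` B w.
  move=> Kv Kw; have [vw|wv] := leP (h v) (h w); [exists v|exists w] => //.
    by move=> z [Kz zv]; split; split => //; exact: le_trans vw.
  by move=> z [Kz zw]; split; split => //; exact: le_trans (ltW wv).
have BF : ProperFilter (filter_from K B).
  apply: filter_from_proper; last by move=> w Kw; exists w; split => //=.
  by apply: filter_from_filter; [exists k0|exact: Bnest].
have [x [Kx xcluster]] : K `&` cluster (filter_from K B) !=set0.
  by apply: Kco; exists k0 => // z [].
exists x => // w Kw; rewrite leNgt; apply/negP => wx.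
have [a wa ax] : exists2 a : R, h w <= a%:E & a%:E < h x.
  move: wx; case: (h w) => [r||] rx; [by exists r|by rewrite ltNge leey in rx|].
  move: rx; case: (h x) => [s _||//].
    by exists (s - 1)%R; rewrite ?leNye// lte_fin ltrBlDr ltrDl.
  by exists 0%R; rewrite ?leNye ?ltry.
have [V xV Va] := hlsc x a ax.
have [z [[_ zw] Vz]] : B w `&` V !=set0 by apply: xcluster => //; exists w.
by have := lt_le_trans (Va z Vz) (le_trans zw wa); rewrite ltxx.
Qed.

Lemma lsc_add_continuous (X : topologicalType) (R : realType) (h : X -> \bar R)
    (q : X -> R) : lower_semicontinuous h -> continuous q ->
  lower_semicontinuous (fun x => h x + (q x)%:E).
Proof.
move=> hlsc qc x a.
rewrite -lteBlDr// -EFinB => ahx.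
have [b ab bx] : exists2 b : R, (a - q x < b)%R & b%:E < h x.
  move: ahx; case: (h x) => [s||]; rewrite ?lte_fin => H.
  - exists ((a - q x + s) / 2)%R; rewrite ?lte_fin; lra.
  - by exists (a - q x + 1)%R; rewrite ?ltrDl ?ltry.
  - by [].
have [V xV Vb] := hlsc x b bx.
have xq : nbhs x [set z | (a - b < q z)%R].
  by apply: (cvgr_gt (q x)) => //; [exact: qc|lra].
exists (V `&` [set z | (a - b < q z)%R]); first exact: filterI.
move=> z [/Vb bz /= qz]; rewrite -lteBlDr// -EFinB.
by apply: le_lt_trans bz; rewrite lee_fin; lra.
Qed.

Lemma lsc_mul_pos (X : topologicalType) (R : realType) (h : X -> \bar R) (c : R) :
  (0 < c)%R -> lower_semicontinuous h -> lower_semicontinuous (fun x => c%:E * h x).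
Proof.
move=> c0 hlsc x a ahx.
have scale z : (a%:E < c%:E * h z) = ((c^-1 * a)%:E < h z).
  by rewrite -lte_pdivrMl.
move: ahx; rewrite scale => /hlsc[V xV Vh]; exists V => // z /Vh.
by rewrite scale.
Qed.

Lemma lsc_sublevel_min (R : realType) (n : nat) (h : 'rV[R]_n -> \bar R) (r : R) x1 :
  lower_semicontinuous h -> h x1 <= r%:E ->
  bounded_set [set w | h w <= r%:E] -> argmin h !=set0.
Proof.
move=> hlsc x1r bnd.
have Kcl : closed [set w | h w <= r%:E].
  rewrite -[X in closed X]setCK; apply: open_closedC.
  have -> : ~` [set w | h w <= r%:E] = [set w | r%:E < h w].
    by apply/seteqP; split=> w /=; [move/negP; rewrite -ltNge|rewrite ltNge => /negP].
  by move/lower_semicontinuousP : hlsc; exact.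
have [] := lsc_compact_min hlsc (bounded_closed_compact bnd Kcl).
  by exists x1.
move=> x xr xmin; exists x => w; have [/xmin//|rw] := leP (h w) r%:E.
exact: le_trans xr (ltW rw).
Qed.

End LowerSemicontinuity.

(** * The proximal operator *)

Section Prox.
Context {R : realType} {n : nat}.
Local Notation E := 'rV[R]_n.
Implicit Types (h g : E -> \bar R) (x p w : E).
Local Open Scope ereal_scope.

(** An affine minorant of h makes h + |. - x|^2 / 2 coercive, so that the choice
    in the definition of [prox] is made in a nonempty set. *)
Lemma prox_argmin h x (s : E) (c : R) x1 (r : R) :
  lower_semicontinuous h -> (forall w, (c + dot s w)%:E <= h w) -> h x1 = r%:E ->
  argmin (fun w => h w + (2^-1 * enorm (w - x) ^+ 2)%:E) (prox h x).
Proof.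
move=> hlsc hmin hx1.
suff /xgetPex : argmin (fun w => h w + (2^-1 * enorm (w - x) ^+ 2)%:E) !=set0 by exact.
pose m := (r + 2^-1 * enorm (x1 - x) ^+ 2)%R.
apply: (@lsc_sublevel_min _ _ _ m x1); last 2 first.
- by rewrite hx1 -EFinD.
- (* M bounds |w - x|^2 on the sublevel set, and |w - x| <= 1 + |w - x|^2 *)
  pose M := (4 * (m - c - dot s x + enorm s ^+ 2))%R.
  exists (enorm x + 1 + M)%R; split; first exact: num_real.
  move=> b Mb w /= wm; apply: le_trans (normr_le_enorm _) _.
  have : (c + dot s w + 2^-1 * enorm (w - x) ^+ 2)%:E <= m%:E.
    by apply: le_trans wm; rewrite EFinD leeD2r.
  rewrite lee_fin => {}wm.
  (* the square of 2 s + (w - x) absorbs the linear term in half of the quadratic one *)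
  have wM : (enorm (w - x) ^+ 2 <= M)%R.
    have := dotxx_ge0 (2 *: s + (w - x))%R.
    move: wm; rewrite /M !sqr_enorm -[in dot s w](subrKC x w) !dotE.
    by rewrite (dotC x s) (dotC w s) (dotC x w); lra.
  have := enormD x (w - x)%R; rewrite subrKC.
  have := enorm_ge0 (w - x)%R; nra.
apply: lsc_add_continuous => // w.
apply: (@cvgM R 'rV[R]_n (nbhs (w : 'rV[R]_n)) (nbhs_filter _)); first exact: cvg_cst.
exact: sqr_enorm_continuous.
Qed.

Lemma ereal_le_fin (v : \bar R) (b : R) : v != -oo -> v <= b%:E ->
  exists2 a, v = a%:E & (a <= b)%R.
Proof. by case: v => // a _; rewrite lee_fin => ab; exists a. Qed.

Lemma argmin_prox_fin h x p w (b : R) : (forall z, h z != -oo) ->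
  argmin (fun w => h w + (2^-1 * enorm (w - x) ^+ 2)%:E) p -> h w = b%:E ->
  exists a, h p = a%:E.
Proof.
move=> hNy /(_ w) + hw; rewrite hw; move: (hNy p).
by case: (h p) => // a _ _; exists a.
Qed.

(** Says that x - p is a subgradient of h at p: compare p with
    p + s (w - p) for small s. *)
Lemma argmin_prox_variational h x p w (a b : R) : (forall z, h z != -oo) ->
  econvex_fun h -> argmin (fun w => h w + (2^-1 * enorm (w - x) ^+ 2)%:E) p ->
  h p = a%:E -> h w = b%:E -> (dot (x - p) (w - p) <= b - a)%R.
Proof.
move=> hNy hconv pmin hp hw; rewrite -subr_ge0.
apply: (@ge0_of_quadratic _ _ (2^-1 * enorm (w - p) ^+ 2)) => s s0 s1.
have s01 : (0 <= s <= 1)%R by rewrite ltW.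
have := hconv w p s s01; rewrite hp hw -!EFinM -EFinD.
move=> /(ereal_le_fin (hNy _))[c hc cle].
have := pmin (s *: w + (1 - s) *: p)%R; rewrite /= hp hc -!EFinD lee_fin.
have -> : (s *: w + (1 - s) *: p - x = p - x + s *: (w - p))%R.
  by apply/rowP => i; rewrite !mxE; ring.
rewrite (sqr_enormD (p - x)%R) enormZ exprMn (ger0_norm (ltW s0)) dotZr -(opprB x p) dotNl.
nra.
Qed.

End Prox.

(** * The proximal gradient operator *)

Definition edomain (R : realType) (n : nat) (g : 'rV[R]_n -> \bar R) : set 'rV[R]_n :=
  [set w | g w \is a fin_num].

(** The objective as a real number, meaningful on the domain of g only; all the
    estimates are carried out in R. *)
Definition real_composite (R : realType) (n : nat) (f : 'rV[R]_n -> R)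
    (g : 'rV[R]_n -> \bar R) (w : 'rV[R]_n) : R :=
  f w + fine (g w).

Section ProximalGradient.
Context {R : realType} {n : nat}.
Local Notation E := 'rV[R]_n.
Context (f : E -> R) (g : E -> \bar R) (L gamma : R) (xs : E)
  (f_convex : convex_function [set: E] f) (f_diff : forall x, differentiable f x)
  (L_ge0 : 0 <= L)
  (f_lip : forall x y, enorm (grad f x - grad f y) <= L * enorm (x - y))
  (g_convex : econvex_fun g) (g_proper : proper_fun g)
  (g_lsc : lower_semicontinuous g) (xs_min : argmin (composite f g) xs)
  (gamma_gt0 : 0 < gamma) (gammaL : gamma * L <= 1).
Implicit Types (x w : E).

Local Notation T := (prox_grad gamma f g).
Local Notation dom := (edomain g).
Local Notation Fr := (real_composite f g).

Let domE w : dom w -> g w = (fine (g w))%:E.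
Proof. by move=> wdom; rewrite fineK. Qed.

Let domP w (b : R) : (g w <= b%:E)%E -> dom w.
Proof. by move=> /(ereal_le_fin (proj1 g_proper w))[a ga _]; rewrite /edomain /= ga. Qed.

Lemma composite_fin w : dom w -> composite f g w = (Fr w)%:E.
Proof. by move=> /domE gw; rewrite /composite {}gw -EFinD. Qed.

Lemma argmin_dom : dom xs.
Proof.
have [_ [w gw]] := g_proper; have wdom : dom w by rewrite /edomain/= fin_numE gw (proj1 g_proper).
have := xs_min w; rewrite (composite_fin wdom) /composite => H.
apply: (@domP _ (Fr w - f xs)); rewrite EFinB leeBrDl//.
Qed.

Lemma argmin_composite_le w : dom w -> Fr xs <= Fr w.
Proof.
by move=> wdom; have := xs_min w; rewrite !composite_fin ?lee_fin//; exact: argmin_dom.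
Qed.

Lemma infval_composite : infval (composite f g) = (Fr xs)%:E.
Proof.
rewrite -(composite_fin argmin_dom); apply/eqP; rewrite eq_le; apply/andP; split.
  by apply: ereal_inf_lbound; exists xs.
by apply: le_ereal_inf_tmp => _ [w _ <-]; exact: xs_min.
Qed.

Lemma convex_dom x w (s : R) : dom x -> dom w -> 0 <= s -> s <= 1 ->
  dom (x + s *: (w - x)) /\
  fine (g (x + s *: (w - x))) <= fine (g x) + s * (fine (g w) - fine (g x)).
Proof.
move=> xdom wdom s0 s1.
have s01 : 0 <= s <= 1 by rewrite s0.
have := g_convex w x s01; rewrite (domE xdom) (domE wdom) -!EFinM -EFinD.
have -> : s *: w + (1 - s) *: x = x + s *: (w - x).
  by rewrite scalerBl scale1r scalerBr addrCA.
move=> gle; have sdom := domP gle; split=> //.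
by move: gle; rewrite (domE sdom) lee_fin => /le_trans; apply; lra.
Qed.

Lemma composite_convex x w (s : R) : dom x -> dom w -> 0 <= s -> s <= 1 ->
  Fr (x + s *: (w - x)) <= Fr x + s * (Fr w - Fr x).
Proof.
move=> xdom wdom s0 s1; have [_] := convex_dom xdom wdom s0 s1.
by have := convex_functionE f_convex x w s0 s1; rewrite /real_composite; lra.
Qed.

(** - grad f xs is a subgradient of g at xs: xs minimizes F, whereas f is below
    its quadratic model at xs. *)
Lemma first_order_optimality w : dom w ->
  fine (g xs) - dot (grad f xs) (w - xs) <= fine (g w).
Proof.
move=> wdom; rewrite -subr_ge0 opprB addrA.
apply: (@ge0_of_quadratic _ _ (L / 2 * enorm (w - xs) ^+ 2)) => s s0 s1.
have [sdom sle] := convex_dom argmin_dom wdom (ltW s0) s1.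
have := argmin_composite_le sdom.
have := descent_lemma xs (s *: (w - xs)) f_diff L_ge0 f_lip.
rewrite /real_composite dotZr enormZ exprMn (ger0_norm (ltW s0)); nra.
Qed.

Lemma prox_grad_argmin x : argmin (fun w => (gamma%:E * g w
  + (2^-1 * enorm (w - (x - gamma *: grad f x)) ^+ 2)%:E)%E) (T x).
Proof.
apply: (@prox_argmin _ _ _ _ (- (gamma *: grad f xs))
  (gamma * (fine (g xs) + dot (grad f xs) xs)) xs (gamma * fine (g xs))).
- exact: lsc_mul_pos.
- move=> w; have [wdom|] := boolP (g w \is a fin_num).
    rewrite (domE wdom) -EFinM lee_fin dotNl dotZl -mulrN -mulrDr ler_pM2l//.
    by have := first_order_optimality wdom; rewrite dotDr dotNr; lra.
  rewrite fin_numE (proj1 g_proper) /= negbK => /eqP ->.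
  by rewrite gt0_muley ?leey.
- by rewrite EFinM fineK//; exact: argmin_dom.
Qed.

Let scale_Ny (c : R) w : 0 <= c -> (c%:E * g w)%E != -oo%E.
Proof.
move=> c0; rewrite mule_eq_ninfty (negPf (proj1 g_proper w)) andbF /=.
by rewrite !orbF lte_fin ltNge c0.
Qed.

Lemma prox_grad_dom x : dom (T x).
Proof.
have hxs : (gamma%:E * g xs)%E = (gamma * fine (g xs))%:E.
  by rewrite EFinM fineK//; exact: argmin_dom.
have [a] := argmin_prox_fin (fun w => scale_Ny w (ltW gamma_gt0))
  (@prox_grad_argmin x) hxs.
rewrite /edomain/= fin_numE (proj1 g_proper) /=; case: (g (T x)) => //.
by rewrite gt0_muley.
Qed.

Lemma prox_grad_variational x w : dom w ->
  dot (x - gamma *: grad f x - T x) (w - T x) <= gamma * (fine (g w) - fine (g (T x))).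
Proof.
move=> wdom; rewrite mulrBr.
apply: (@argmin_prox_variational _ _ (fun w => gamma%:E * g w)%E) => //.
- by move=> z; apply: scale_Ny; exact: ltW.
- move=> z w' s s01; have /andP[s0 s1] := s01.
  rewrite muleCA (muleCA _ gamma%:E) -muleDr//.
    by rewrite lee_pmul2l//; exact: g_convex.
  by apply: ltninfty_adde_def; rewrite inE ltNye scale_Ny// subr_ge0.
- exact: prox_grad_argmin.
- by rewrite EFinM fineK//; exact: prox_grad_dom.
- by rewrite EFinM fineK.
Qed.

(** Adds up three estimates of F (T x) - F w: the descent lemma between x and
    T x, where gamma * L <= 1 is used, the gradient inequality of f between x
    and w, and the variational inequality of the prox for g. *)
Lemma prox_grad_inequality x w : dom w ->
  gamma * Fr (T x) + 2^-1 * enorm (T x - w) ^+ 2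
    <= gamma * Fr w + 2^-1 * enorm (x - w) ^+ 2.
Proof.
move=> wdom.
have /= V := prox_grad_variational x wdom.
have := descent_lemma x (T x - x) f_diff L_ge0 f_lip; rewrite subrKC.
have G := grad_inequality x w f_convex f_diff L_ge0 f_lip.
move: V; set p := T x; move=> V D.
have D' : gamma * f p <= gamma * f x + gamma * dot (grad f x) (p - x)
    + 2^-1 * enorm (p - x) ^+ 2.
  have := ler_wpM2r (sqr_ge0 (enorm (p - x))) gammaL.
  by move: D; rewrite -(ler_pM2l gamma_gt0); lra.
have G' : gamma * f x + gamma * dot (grad f x) (w - x) <= gamma * f w.
  by rewrite -mulrDr ler_pM2l.
move: V D' G'; rewrite /real_composite !sqr_enorm !dotE.
rewrite (dotC p x) (dotC w x) (dotC w p); lra.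
Qed.

(** The subgradient of g at T x given by the prox is
    (x - T x) / gamma - grad f x; adding grad f (T x) gives one of F. *)
Lemma prox_grad_subgradient x :
  subdiff (composite f g) (T x)
    (gamma^-1 *: (x - T x) + (grad f (T x) - grad f x)).
Proof.
move=> w; rewrite (composite_fin (prox_grad_dom x)) -EFinD.
have [wdom|] := boolP (g w \is a fin_num); last first.
  rewrite /composite fin_numE (proj1 g_proper) /= negbK => /eqP ->.
  by rewrite addey ?leey.
rewrite (composite_fin wdom) lee_fin /real_composite.
have V := prox_grad_variational x wdom.
have G := grad_inequality (T x) w f_convex f_diff L_ge0 f_lip.
have {V}V : gamma^-1 * dot (x - T x) (w - T x) - dot (grad f x) (w - T x)
   <= fine (g w) - fine (g (T x)).
  rewrite -(ler_pM2l gamma_gt0); apply: le_trans V.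
  rewrite mulrBr mulVKf ?gt_eqF//.
  by rewrite addrAC (dotDl (x - T x)) dotNl dotZl.
rewrite dotDl dotZl (dotDl (grad f (T x))) dotNl; lra.
Qed.

Lemma dist0_subdiff_prox_grad x :
  (dist0 (subdiff (composite f g) (T x))
    <= ((gamma^-1 + L) * enorm (T x - x))%:E)%E.
Proof.
apply: (@le_trans _ _ (enorm (gamma^-1 *: (x - T x) + (grad f (T x) - grad f x)))%:E).
  apply: ereal_inf_lbound; exists (gamma^-1 *: (x - T x) + (grad f (T x) - grad f x)) => //.
  exact: prox_grad_subgradient.
rewrite lee_fin (le_trans (enormD _ _))// mulrDl lerD//.
by rewrite enormZ gtr0_norm ?invr_gt0// -(opprB (T x)) enormN.
Qed.

Lemma argmin_composite_eq w : dom w -> argmin (composite f g) w -> Fr w = Fr xs.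
Proof.
move=> wdom /(_ xs); rewrite (composite_fin wdom) (composite_fin argmin_dom) lee_fin => wxs.
by apply/eqP; rewrite eq_le wxs argmin_composite_le.
Qed.

(** The KL inequality bounds the gap by a distance to the subdifferential, and
    hence by the length of the step that led to the point. *)
Lemma KL_residual (theta C : R) x : KL (composite f g) theta C ->
  ~ argmin (composite f g) (T x) ->
  C^-1 * (Fr (T x) - Fr xs) `^ (1 - theta) <= (gamma^-1 + L) * enorm (T x - x).
Proof.
move=> kl /kl; rewrite (composite_fin (prox_grad_dom x)) infval_composite.
rewrite -EFinB poweR_EFin -EFinM => /le_trans/(_ (dist0_subdiff_prox_grad x)).
by rewrite lee_fin.
Qed.

(** * Energy of the alternated extrapolation *)

Section AlternatedExtrapolation.
Context (t : nat -> R) (x0 : E) (x y : nat -> E)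
  (t0 : t 0%N = 0) (t_ge1 : forall j, 1 <= t j.+1)
  (t_sqr : forall j, t j.+1 ^+ 2 - t j.+1 <= t j ^+ 2)
  (xy_iter : alternated_extrapolation T t x0 x y).

(** The point z_j: the even iterate pushed beyond itself, away from the
    preceding odd iterate. At j = 0 both iterates are x0, since 0.-1 = 0. *)
Definition lyapunov_point j : E :=
  y j.*2 + (t j - 1) *: (y j.*2 - y j.*2.-1).

Definition lyapunov j : R :=
  2 * gamma * t j ^+ 2 * (Fr (y j.*2) - Fr xs) + enorm (lyapunov_point j - xs) ^+ 2.

Lemma iter_even j : x j.*2 = y j.*2.
Proof.
have [x00 y00 step] := xy_iter; case: j => [|j]; first by rewrite x00 y00.
have [_ _ _ xS] := step j.*2 (negbT (odd_double j)).
by rewrite doubleS.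
Qed.

Lemma iter_odd j : y j.*2.+1 = T (y j.*2).
Proof.
have [_ _ step] := xy_iter.
have [-> _ _ _] := step j.*2 (negbT (odd_double j)).
by rewrite iter_even.
Qed.

(** The two extrapolation terms amount to moving from y_{2j+1} towards z_j by
    the fraction 1 / t_{j+1}, which is what makes the energy telescope. *)
Lemma iter_even_succ j : y j.+1.*2 =
  T (y j.*2.+1 + (t j.+1)^-1 *: (lyapunov_point j - y j.*2.+1)).
Proof.
have [_ _ step] := xy_iter.
have [_ xS yS _] := step j.*2 (negbT (odd_double j)).
rewrite doubleS yS xS doubleK; congr (T _).
have tn0 : t j.+1 != 0 by rewrite gt_eqF// (lt_le_trans ltr01).
by apply/rowP => i; rewrite !mxE; field.
Qed.

(** The test point w divides the segment from v to xs in the same ratio as the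
    extrapolated point w1 divides the one from v to z. Hence both distances in
    the proximal gradient inequality are 1 / t_{j+1} times distances to xs. *)
Lemma lyapunov_decrease j :
  lyapunov j.+1 + t j ^+ 2 * enorm (T (y j.*2) - y j.*2) ^+ 2 <= lyapunov j.
Proof.
rewrite /lyapunov /lyapunov_point doubleS -[j.*2.+2.-1]/(j.*2.+1) -doubleS.
rewrite iter_even_succ -iter_odd; set u := y j.*2; set v := y j.*2.+1.
set z := lyapunov_point j; set s := t j.+1.
have s1 : 1 <= s by exact: t_ge1.
have s0 : 0 < s by apply: lt_le_trans s1.
set w1 := v + s^-1 *: (z - v); set u' := T w1.
pose w := v + s^-1 *: (xs - v).
have vdom : dom v by rewrite /v iter_odd; exact: prox_grad_dom.
have sV0 : 0 < s^-1 by rewrite invr_gt0.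
have si0 := ltW sV0.
have si1 : s^-1 <= 1 by rewrite invf_le1.
have [wdom _] := convex_dom vdom argmin_dom si0 si1.
have wle := composite_convex vdom argmin_dom si0 si1.
have vge := argmin_composite_le vdom.
have := prox_grad_inequality w1 wdom; rewrite -/u' -/w => P1.
have ew1 : enorm (w1 - w) ^+ 2 = s ^- 2 * enorm (z - xs) ^+ 2.
  have -> : w1 - w = s^-1 *: (z - xs) by apply/rowP => i; rewrite !mxE; ring.
  by rewrite enormZ (gtr0_norm sV0) exprMn exprVn.
have eu' : enorm (u' - w) ^+ 2 = s ^- 2 * enorm (u' + (s - 1) *: (u' - v) - xs) ^+ 2.
  have -> : u' - w = s^-1 *: (u' + (s - 1) *: (u' - v) - xs).
    by apply/rowP => i; rewrite !mxE; field; rewrite gt_eqF.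
  by rewrite enormZ (gtr0_norm sV0) exprMn exprVn.
(* the proximal gradient inequality at w1 and w, multiplied by 2 s^2 *)
have P1' : 2 * gamma * s ^+ 2 * Fr u' + enorm (u' + (s - 1) *: (u' - v) - xs) ^+ 2
    <= 2 * gamma * s ^+ 2 * Fr w + enorm (z - xs) ^+ 2.
  have unscale (a b : R) : 2 * s ^+ 2 * (gamma * a + 2^-1 * (s ^- 2 * b))
      = 2 * gamma * s ^+ 2 * a + b by field; rewrite gt_eqF.
  rewrite -!unscale -ew1 -eu' ler_wpM2l//.
  by rewrite mulr_ge0// sqr_ge0.
(* convexity of F at w *)
have P2 : 2 * gamma * s ^+ 2 * (Fr w - Fr xs)
    <= 2 * gamma * ((s ^+ 2 - s) * (Fr v - Fr xs)).
  rewrite -mulrA ler_pM2l ?mulr_gt0//.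
  apply: (@le_trans _ _ (s ^+ 2 * ((1 - s^-1) * (Fr v - Fr xs)))).
    by rewrite ler_pM2l ?exprn_gt0//; move: wle; rewrite -/w; lra.
  by rewrite le_eqVlt; apply/orP; left; apply/eqP; field; rewrite gt_eqF.
(* gain of the plain step from u to v; for j = 0 the factor t 0 = 0 makes it
   hold although u may lie outside the domain *)
have P3 : 2 * gamma * (t j ^+ 2 * (Fr v - Fr xs)) + t j ^+ 2 * enorm (v - u) ^+ 2
    <= 2 * gamma * (t j ^+ 2 * (Fr u - Fr xs)).
  case: (posnP j) => [j0|jpos]; first by rewrite j0 t0 expr0n !mul0r mulr0 addr0.
  have udom : dom u.
    by rewrite /u -(prednK jpos) iter_even_succ; exact: prox_grad_dom.
  have := prox_grad_inequality u udom; rewrite -iter_odd -/u -/v subrr.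
  rewrite (_ : enorm (0 : E) = 0); last first.
    by rewrite -(scale0r (0 : E)) enormZ normr0 mul0r.
  rewrite expr0n mulr0 addr0 => H.
  have := ler_wpM2l (mulr_ge0 (ler0n R 2) (sqr_ge0 (t j))) H.
  lra.
(* the growth condition on the step sizes *)
have P4 : 2 * gamma * ((s ^+ 2 - s) * (Fr v - Fr xs))
    <= 2 * gamma * (t j ^+ 2 * (Fr v - Fr xs)).
  by rewrite ler_pM2l ?mulr_gt0// ler_wpM2r ?subr_ge0//; exact: t_sqr.
rewrite -/(lyapunov_point j) -/z; lra.
Qed.

Lemma lyapunov_ge0 j : 0 <= lyapunov j.
Proof.
apply: addr_ge0; last exact: sqr_ge0.
case: j => [|j]; first by rewrite t0 expr0n mulr0 mul0r.
apply: mulr_ge0; first by rewrite mulr_ge0 ?sqr_ge0// mulr_ge0// ltW.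
rewrite subr_ge0; apply: argmin_composite_le.
by rewrite iter_even_succ; exact: prox_grad_dom.
Qed.

Lemma lyapunov_le j : lyapunov j <= enorm (x0 - xs) ^+ 2.
Proof.
elim: j => [|j IH]; last first.
  apply: le_trans IH; apply: le_trans (lyapunov_decrease j).
  by rewrite lerDl mulr_ge0 ?sqr_ge0.
have [_ y00 _] := xy_iter.
by rewrite /lyapunov /lyapunov_point t0 expr0n mulr0 mul0r add0r subrr scaler0 addr0 y00.
Qed.

Lemma composite_even_le j :
  2 * gamma * t j ^+ 2 * (Fr (y j.*2) - Fr xs) <= enorm (x0 - xs) ^+ 2.
Proof. by apply: le_trans (lyapunov_le j); rewrite lerDl sqr_ge0. Qed.

(** The energy is nonincreasing and nonnegative, so its increments, which
    dominate the residuals, tend to 0. *)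
Lemma residual_cvg0 :
  t j ^+ 2 * enorm (T (y j.*2) - y j.*2) ^+ 2 @[j --> \oo] --> (0 : R).
Proof.
have anti : nonincreasing_seq lyapunov.
  apply/nonincreasing_seqP => j; apply: le_trans (lyapunov_decrease j).
  by rewrite lerDl mulr_ge0 ?sqr_ge0.
have /cvg_ex[l lyap_l] : cvgn lyapunov.
  apply: nonincreasing_is_cvgn => //.
  by exists 0 => _ [j _ <-]; exact: lyapunov_ge0.
apply: (@squeeze_cvgr _ _ _ _ (cst 0) (fun j => lyapunov j - lyapunov j.+1)).
- by near=> j; rewrite mulr_ge0 ?sqr_ge0//= lerBrDl lyapunov_decrease.
- exact: cvg_cst.
- rewrite -(subrr l); apply: cvgB => //.
  by rewrite -cvg_shiftS in lyap_l.
Unshelve. all: by end_near. Qed.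

End AlternatedExtrapolation.

End ProximalGradient.

(** * The two families of step sizes *)

Section StepSizes.
Context {R : realType} (t : nat -> R) (t0 : t 0%N = 0).

(** t_{j+1} is the root of X^2 - X = t_j^2, so the last condition holds with
    equality; the linear growth comes from sqrt (1 + 4 t^2) >= 2 t. *)
Lemma nesterov_stepP : nesterov_step t ->
  [/\ forall j, j%:R / 2 <= t j, forall j, 1 <= t j.+1
    & forall j, t j.+1 ^+ 2 - t j.+1 <= t j ^+ 2].
Proof.
move=> step.
have tlin j : j%:R / 2 <= t j.
  elim: j => [|j IH]; first by rewrite t0 mul0r.
  have tj0 : 0 <= t j by apply: le_trans IH; rewrite divr_ge0.
  have : 2 * t j <= Num.sqrt (1 + 4 * t j ^+ 2).
    rewrite -[leLHS]ger0_norm ?mulr_ge0// -sqrtr_sqr ler_wsqrtr//; lra.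
  rewrite step -[j.+1%:R]natr1; lra.
split=> // j; rewrite step.
  have : 1 <= Num.sqrt (1 + 4 * t j ^+ 2).
    by rewrite -[leLHS]sqrtr1 ler_wsqrtr// lerDl mulr_ge0// sqr_ge0.
  lra.
have : Num.sqrt (1 + 4 * t j ^+ 2) ^+ 2 = 1 + 4 * t j ^+ 2.
  by rewrite sqr_sqrtr// addr_ge0// mulr_ge0// sqr_ge0.
lra.
Qed.

(** With b = 1/a, the last condition for j >= 1 amounts to
    0 <= b m (1 - 2 b) + 1 - b - b^2 with m = j - 1, hence the assumption
    a > 2. *)
Lemma affine_stepP : affine_step t ->
  exists2 c : R, 0 < c & [/\ forall j, c * j%:R <= t j, forall j, 1 <= t j.+1
    & forall j, t j.+1 ^+ 2 - t j.+1 <= t j ^+ 2].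
Proof.
move=> [a a2 step]; have a0 : 0 < a by lra.
exists a^-1; first by rewrite invr_gt0.
have tS j : t j.+1 = 1 + a^-1 * j%:R by rewrite step; field; rewrite gt_eqF.
have ai0 : 0 < a^-1 by rewrite invr_gt0.
have ai2 : 2 * a^-1 < 1 by rewrite -ltr_pdivlMr ?invr_gt0// invrK mul1r.
split=> [[|j]|j|[|j]]; rewrite ?tS ?t0 ?mulr0//.
- rewrite -[j.+1%:R]natr1; lra.
- by rewrite lerDl mulr_ge0// ltW.
- by rewrite addr0 expr1n subrr expr0n.
- rewrite -[j.+1%:R]natr1; have : 0 <= j%:R :> R by [].
  move: ai0 ai2; move: (a^-1) (j%:R) => b m b0 b2 m0.
  have b21 : 0 <= 1 - 2 * b by lra.
  have := mulr_ge0 (mulr_ge0 (ltW b0) m0) b21.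
  have := mulr_ge0 (ltW b0) b21; lra.
Qed.

End StepSizes.

(** * Asymptotics along a parity *)

Section ParityFilters.
Context {R : realType}.
Implicit Types (u v : nat -> R) (P : set nat).

Lemma near_even_infty P :
  (\forall j \near \oo, P j.*2) -> \forall k \near even_infty, P k.
Proof.
move=> [N _ NP]; exists N.*2 => // k /= Nk keven.
have kE : k = k./2.*2 by rewrite even_halfK.
by rewrite kE; apply: NP => /=; rewrite -(doubleK N) half_leq.
Qed.

Lemma near_odd_infty P :
  (\forall j \near \oo, P j.*2.+1) -> \forall k \near odd_infty, P k.
Proof.
move=> [N _ NP]; exists N.*2 => // k /= Nk kodd.
have kE : k = k./2.*2.+1 by rewrite -[LHS]odd_double_half kodd.
by rewrite kE; apply: NP => /=; rewrite -(doubleK N) half_leq.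
Qed.

Lemma even_littleo u v :
  (forall eps, 0 < eps -> \forall j \near \oo, `|u j.*2| <= eps * `|v j.*2|) ->
  (u : nat -> R^o) =o_even_infty (v : nat -> R^o).
Proof.
by move=> uv; apply/eqoP => eps eps0; apply: near_even_infty; exact: uv.
Qed.

Lemma odd_littleo u v :
  (forall eps, 0 < eps -> \forall j \near \oo, `|u j.*2.+1| <= eps * `|v j.*2.+1|) ->
  (u : nat -> R^o) =o_odd_infty (v : nat -> R^o).
Proof.
by move=> uv; apply/eqoP => eps eps0; apply: near_odd_infty; exact: uv.
Qed.

Lemma even_bigO u v (K : R) : 0 < K ->
  (\forall j \near \oo, `|u j.*2| <= K * `|v j.*2|) ->
  (u : nat -> R^o) =O_even_infty (v : nat -> R^o).
Proof.
by move=> K0 uv; apply/eqO_exP; exists K => //; apply: near_even_infty.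
Qed.

End ParityFilters.

Section Rates.
Context {R : realType}.

(** Raises d^(1 - theta) k <= e^(1 - theta) to the power 1 / (1 - theta). *)
Lemma gap_powR_le (theta a d k e : R) : theta < 1 -> 0 <= d ->
  0 < k -> 0 < e -> d `^ (1 - theta) <= a -> a * k <= e `^ (1 - theta) ->
  d <= e * (1 / k `^ (1 / (1 - theta))).
Proof.
move=> theta1 d0 k0 e0 da ak; set p := 1 / (1 - theta).
have th : 0 < 1 - theta by rewrite subr_gt0.
have p0 : 0 <= p by rewrite divr_ge0// ltW.
have powK (b : R) : 0 <= b -> (b `^ (1 - theta)) `^ p = b.
  by move=> b0; rewrite -powRrM mulrC divfK ?gt_eqF// powRr1.
have k_ge0 := ltW k0.
rewrite mul1r ler_pdivlMr ?powR_gt0// -[d]powK// -powRM ?powR_ge0// -[e]powK ?(ltW e0)//.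
apply: ge0_ler_powR => //; rewrite ?nnegrE ?mulr_ge0 ?powR_ge0//.
by apply: le_trans ak; rewrite ler_pM2r.
Qed.

(** From t_j r_j -> 0 and c j <= t_j, with 2j + 1 <= 3j for j >= 1: this is
    where the constant 3 comes from. *)
Lemma residual_rate (t r : nat -> R) (c : R) : 0 < c ->
  (forall j, c * j%:R <= t j) -> (forall j, 0 <= r j) ->
  t j ^+ 2 * r j ^+ 2 @[j --> \oo] --> (0 : R) ->
  forall eta : R, 0 < eta -> \forall j \near \oo, j.*2.+1%:R * r j <= eta.
Proof.
move=> c0 ct r0 tr eta eta0.
have q0 : 0 < c * eta / 3 by rewrite divr_gt0// mulr_gt0.
have e0 : 0 < (c * eta / 3) ^+ 2 by rewrite exprn_gt0.
have /cvgr0_norm_le/(_ _ e0) := tr; apply: filterS2 (nbhs_infty_gt 0) => j j0.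
have t_ge0 : 0 <= t j by apply: le_trans (ct j); rewrite mulr_ge0// ltW.
have tr_ge0 : 0 <= t j * r j by rewrite mulr_ge0.
rewrite -exprMn normrX (ger0_norm tr_ge0) ler_pXn2r ?nnegrE ?(ltW q0)// => trj.
have j1 : 1 <= j%:R :> R by rewrite ler1n.
have := ler_wpM2r (r0 j) (ct j); have := ler_wpM2r (r0 j) j1.
rewrite -[j.*2.+1%:R]natr1 -muln2 natrM => jr cjr.
rewrite -(ler_pM2l c0).
have := ler_wpM2l (ltW c0) jr; lra.
Qed.

End Rates.

(** * Convergence rates *)

Theorem proposition4p3 (R : realType) (n : nat)
  (f : 'rV[R]_n -> R) (g : 'rV[R]_n -> \bar R) (L : R)
  (f_convex : convex_function [set: 'rV[R]_n] f)
  (f_diff : forall x : 'rV[R]_n, differentiable f x)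
  (L_gt0 : 0 < L)
  (f_lip : forall x y : 'rV[R]_n,
     enorm (grad f x - grad f y) <= L * enorm (x - y))
  (g_convex : econvex_fun g) (g_proper : proper_fun g)
  (g_lsc : lower_semicontinuous g)
  (argmin_nonempty : argmin (composite f g) !=set0)
  (argmin_closed : closed (argmin (composite f g)))
  (min_gtNy : (-oo < infval (composite f g))%E)
  (xstar : 'rV[R]_n) (xstar_min : argmin (composite f g) xstar)
  (gamma : R) (gamma_gt0 : 0 < gamma) (gamma_le : gamma <= 1 / L)
  (t : nat -> R) (t0 : t 0%N = 0)
  (t_step : nesterov_step t \/ affine_step t)
  (x0 : 'rV[R]_n) (x y : nat -> 'rV[R]_n)
  (xy_iter : alternated_extrapolation (prox_grad gamma f g) t x0 x y) :
  let F := composite f g in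
  let Fstar := infval F in
  let T := prox_grad gamma f g in
  [/\ (* the division is that of \bar R, so the bound at k = 0 (where t 0 = 0)
         is +oo, unless x0 = xstar, when it is 0 *)
      (forall k, ~~ odd k ->
        (F (y k) - Fstar <=
           (enorm (x0 - xstar) ^+ 2)%:E / (2 * gamma * t k./2 ^+ 2)%:E)%E),
      (fun k => enorm (x0 - xstar) ^+ 2 / (2 * gamma * t k./2 ^+ 2) : R^o)
        =O_even_infty (fun k => 1 / k%:R ^+ 2 : R^o),
      (fun k => enorm (T (y k) - y k) ^+ 2 : R^o)
        =o_even_infty (fun k => 1 / t k./2 ^+ 2 : R^o),
      (fun k => enorm (T (y k) - y k) ^+ 2 : R^o)
        =o_even_infty (fun k => 1 / k%:R ^+ 2 : R^o) &
      forall theta C : R, 0 < theta -> theta <= 1 -> 0 < C ->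
        KL F theta C ->
        odd_elittleo (fun k => (F (y k) - Fstar)%E) (KL_rate theta)].
Proof.
have L_ge0 := ltW L_gt0.
have gammaL : gamma * L <= 1 by rewrite -ler_pdivlMr.
have [c c0 [ct t_ge1 t_sqr]] : exists2 c : R, 0 < c & [/\ forall j, c * j%:R <= t j,
    forall j, 1 <= t j.+1 & forall j, t j.+1 ^+ 2 - t j.+1 <= t j ^+ 2].
  case: t_step => [/(nesterov_stepP t0)[tj t1 t2]|]; last exact: affine_stepP.
  by exists 2^-1 => //; split=> // j; rewrite mulrC.
move=> F Fstar T.
have FstarE : Fstar = (real_composite f g xstar)%:E.
  exact: (infval_composite g_proper).
have ydom j : edomain g (T (y j)).
  exact: (prox_grad_dom (f := f) (L := L) (xs := xstar)).
have even_bound := composite_even_le f_convex f_diff L_ge0 f_lip g_convex g_proper g_lsc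
  xstar_min gamma_gt0 gammaL t0 t_ge1 t_sqr xy_iter.
have res0 := residual_cvg0 f_convex f_diff L_ge0 f_lip g_convex g_proper g_lsc
  xstar_min gamma_gt0 gammaL t0 t_ge1 t_sqr xy_iter.
have odd_iter := iter_odd xy_iter.
have even_succ := iter_even_succ t_ge1 xy_iter.
have tpos j : (0 < j)%N -> 0 < t j.
  by case: j => // j _; apply: lt_le_trans (t_ge1 j).
pose D := enorm (x0 - xstar) ^+ 2.
(* 1 / t_j^2 = O(1 / (2j)^2) *)
have rate_t j : (0 < j)%N -> 1 / t j ^+ 2 <= (4 / c ^+ 2) * (1 / j.*2%:R ^+ 2).
  move=> j0; have jpos : 0 < j%:R :> R by rewrite ltr0n.
  have -> : 4 / c ^+ 2 * (1 / j.*2%:R ^+ 2) = 1 / (c * j%:R) ^+ 2 :> R.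
    by rewrite -muln2 natrM; field; rewrite !gt_eqF.
  rewrite !mul1r lef_pV2 ?posrE ?exprn_gt0 ?mulr_gt0 ?tpos//.
  by rewrite ler_pXn2r ?nnegrE ?mulr_ge0 ?(ltW c0) ?(ltW (tpos _ j0)).
have sq_res eps : 0 < eps -> \forall j \near \oo,
    enorm (T (y j.*2) - y j.*2) ^+ 2 <= eps * (1 / t j ^+ 2).
  move=> eps0; have /cvgr0_norm_le/(_ _ eps0) := res0; apply: filterS2 (nbhs_infty_gt 0) => j j0.
  rewrite ger0_norm; last exact: mulr_ge0 (sqr_ge0 _) (sqr_ge0 _).
  move=> H.
  by rewrite mul1r ler_pdivlMr ?exprn_gt0 ?tpos// mulrC.
split.
- move=> k keven; rewrite -(even_halfK keven) doubleK FstarE inver.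
  case: (posnP k./2) => [->|]; last first.
    move=> j0; have tj := tpos _ j0.
    have den0 : 0 < 2 * gamma * t k./2 ^+ 2 by rewrite mulr_gt0 ?exprn_gt0 ?mulr_gt0.
    rewrite gt_eqF// -EFinM /F composite_fin; last first.
      by rewrite -(prednK j0) even_succ; exact: (prox_grad_dom (f := f) (L := L) (xs := xstar)).
    by rewrite -EFinB lee_fin ler_pdivlMr// mulrC.
  (* here j = 0: the right-hand side is +oo, or 0 * +oo = 0 if x0 = xstar *)
  rewrite t0 expr0n mulr0 eqxx.
  have [_ -> _] := xy_iter.
  have [D0|Dn0] := eqVneq (enorm (x0 - xstar) ^+ 2) 0.
    rewrite D0 mul0e.
    have -> : x0 = xstar.
      apply/eqP; rewrite -subr_eq0 -normr_le0 (le_trans (normr_le_enorm _))//.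
      by rewrite le_eqVlt -sqrf_eq0 D0 eqxx.
    by rewrite /F composite_fin ?subee//; exact: (argmin_dom g_proper xstar_min).
  by rewrite gt0_muley ?leey// lte_fin lt_def Dn0 sqr_ge0.
- apply: (@even_bigO _ _ _ ((D + 1) / (2 * gamma) * (4 / c ^+ 2))).
    rewrite mulr_gt0 ?divr_gt0 ?exprn_gt0 ?mulr_gt0//.
    by rewrite ltr_wpDl ?sqr_ge0.
  near=> j.
  have j0 : (0 < j)%N by near: j; exact: nbhs_infty_gt.
  have tj := tpos _ j0.
  have den0 : 0 < 2 * gamma * t j ^+ 2 by rewrite mulr_gt0 ?exprn_gt0 ?mulr_gt0.
  rewrite doubleK !ger0_norm ?divr_ge0 ?sqr_ge0 ?(ltW den0)//.
  have -> : enorm (x0 - xstar) ^+ 2 / (2 * gamma * t j ^+ 2)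
    = D / (2 * gamma) * (1 / t j ^+ 2) by rewrite /D; field; rewrite !gt_eqF.
  have g20 : 0 < 2 * gamma by rewrite mulr_gt0.
  have D0 : 0 <= D by exact: sqr_ge0.
  rewrite -[leRHS]mulrA ler_pM ?rate_t ?divr_ge0 ?sqr_ge0 ?(ltW g20)//.
  by rewrite ler_pM2r ?invr_gt0// lerDl.
- apply: even_littleo => eps eps0.
  apply: filterS (sq_res eps eps0) => j; rewrite doubleK.
  by rewrite !ger0_norm ?divr_ge0 ?sqr_ge0.
- apply: even_littleo => eps eps0.
  have eps'0 : 0 < eps / (4 / c ^+ 2) by rewrite !divr_gt0 ?exprn_gt0.
  apply: filterS2 (nbhs_infty_gt 0) (sq_res _ eps'0) => j j0 H.
  rewrite !ger0_norm ?divr_ge0 ?sqr_ge0//; apply: le_trans H _.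
  rewrite -mulrA ler_pM2l// ler_pdivrMl ?divr_gt0 ?exprn_gt0//.
  exact: rate_t.
move=> theta C theta0 theta1 C0 kl.
have gapE j : (F (y j.*2.+1) - Fstar)%E
    = (real_composite f g (y j.*2.+1) - real_composite f g xstar)%:E.
  by rewrite FstarE /F composite_fin ?EFinB// odd_iter.
split; first by apply: near_odd_infty; near=> j; rewrite gapE.
apply: odd_littleo => eps eps0; rewrite /KL_rate.
pose M := gamma^-1 + L.
have M0 : 0 < M by rewrite addr_gt0 ?invr_gt0.
pose r j := enorm (T (y j.*2) - y j.*2).
have small := @residual_rate _ t r c c0 ct (fun=> enorm_ge0 _) res0.
have CM0 : 0 < C * M by rewrite mulr_gt0.
have gap_ge0 j : 0 <= real_composite f g (y j.*2.+1) - real_composite f g xstar.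
  rewrite subr_ge0 odd_iter; exact: argmin_composite_le.
have gap j : real_composite f g (y j.*2.+1) - real_composite f g xstar = 0 \/
    (real_composite f g (y j.*2.+1) - real_composite f g xstar) `^ (1 - theta) <= C * M * r j.
  have [vmin|vmin] := pselect (argmin F (y j.*2.+1)).
    left; apply/eqP; rewrite subr_eq0; apply/eqP.
    by apply: argmin_composite_eq => //; rewrite odd_iter.
  right; rewrite odd_iter in vmin *.
  rewrite -mulrA -ler_pdivrMl//.
  exact: (KL_residual f_convex f_diff L_ge0 f_lip).
have [thetaE|thetaN1] := eqVneq theta 1.
  (* the gap to the power 0 is 1, and C * M * r j < 1 eventually *)
  have eta0 : 0 < (C * M)^-1 / 2 by rewrite divr_gt0 ?invr_gt0.
  apply: filterS (small _ eta0) => j rj.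
  rewrite normr0 mulr0 gapE /= normr_le0; apply/eqP.
  case: (gap j) => //; rewrite thetaE subrr powRr0 => H.
  have : r j <= (C * M)^-1 / 2.
    by apply: le_trans rj; rewrite ler_peMl ?enorm_ge0// ler1n.
  rewrite -(ler_pM2l CM0) mulrA divff ?gt_eqF//; lra.
have theta_lt1 : theta < 1 by rewrite lt_def eq_sym thetaN1.
have eta0 : 0 < eps `^ (1 - theta) / (C * M) by rewrite divr_gt0 ?powR_gt0.
apply: filterS (small _ eta0) => j rj.
rewrite gapE /= !ger0_norm ?divr_ge0 ?powR_ge0//.
case: (gap j) => [->|H]; first by rewrite mulr_ge0 ?divr_ge0 ?powR_ge0 ?(ltW eps0).
apply: gap_powR_le H _ => //.
by rewrite -mulrA mulrC -ler_pdivlMr// mulrC.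
Unshelve. all: by end_near. Qed.
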